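(* Let $G$ be a two-player stage game and consider the mixed-mixed regime. There exist a positive integer $T$ and an SPE of $G(T)$ in which locally suboptimal behavior occurs if and only if at least one of the following holds: (1) $|V_1^{m,m}|>1$, $|V_2^{m,m}|>1$, and there exist $\hat\sigma_1\in\Delta A_1,\hat\sigma_2\in\Delta A_2$ with $(\hat\sigma_1,\hat\sigma_2)\notin\mathrm{Nash}^{m,m}(G)$; (2) $|V_1^{m,m}|>1$, $|V_2^{m,m}|=1$, and there exist $\hat\sigma_1\in\Delta A_1$, $\hat\sigma_2\in\Delta A_2$, $a_1'\in A_1$ with $u_1(\hat\sigma_1,\hat\sigma_2)<u_1(a_1',\hat\sigma_2)$ and $\hat\sigma_2$ a best response to $\hat\sigma_1$; (3) $|V_1^{m,m}|=1$, $|V_2^{m,m}|>1$, and there exist $\hat\sigma_1\in\Delta A_1$, $\hat\sigma_2\in\Delta A_2$, $a_2'\in A_2$ with $u_2(\hat\sigma_1,\hat\sigma_2)<u_2(\hat\sigma_1,a_2')$ and $\hat\sigma_1$ a best response to $\hat\sigma_2$.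
   Context: A two-player stage game $G$ consists of finite nonempty action sets $A_1,A_2$ and payoff functions $u_1,u_2:A_1\times A_2\to\mathbb{R}$, extended to mixed strategies $\sigma_i\in\Delta A_i$ by expectation. A strategy is a best response to the opponent's strategy if it maximizes expected payoff against it. For an integer $T\ge1$, $G(T)$ is the $T$-round repetition of $G$ in which after each round both realized actions are observed and each player's payoff is the expected sum of stage payoffs over the $T$ rounds. In the mixed-mixed regime a strategy of player $i$ in $G(T)$ is a behavior strategy $\mu_i:\bigcup_{k=0}^{T-1}(A_1\times A_2)^k\to\Delta A_i$. A profile $\mu$ is a subgame-perfect equilibrium (SPE) if for every $0\le k<T$ and every history $h$ of length $k$, the continuation profile $\mu_{|h}$ (with $\mu_{i|h}(h')=\mu_i(h,h')$) is a Nash equilibrium of $G(T-k)$. $\mathrm{Nash}^{m,m}(G)$ is the set of mixed Nash equilibria of $G$ and $V_i^{m,m}=\{u_i(\sigma):\sigma\in\mathrm{Nash}^{m,m}(G)\}$. Locally suboptimal behavior occurs in an SPE $\mu$ of $G(T)$ if there exist $0\le k<T$ and a history $h$ of length $k$ with $(\mu_1(h),\mu_2(h))\notin\mathrm{Nash}^{m,m}(G)$. *)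

(* Defs.v *)
From HB Require Import structures.
From mathcomp Require Import all_boot all_order all_algebra.
From mathcomp Require Import reals.
Set Implicit Arguments. Unset Strict Implicit. Unset Printing Implicit Defensive.
Import Order.TTheory GRing.Theory Num.Theory.
Local Open Scope ring_scope.

Section Games.
Context {R : realType} {A1 A2 : finType}.

Definition mixed (A : finType) (s : {ffun A -> R}) : Prop :=
  (forall a, 0 <= s a) /\ \sum_(a : A) s a = 1.

Definition pure (A : finType) (a : A) : {ffun A -> R} := [ffun b => (b == a)%:R].

Definition eu (u : A1 -> A2 -> R) (s1 : {ffun A1 -> R}) (s2 : {ffun A2 -> R}) : R :=
  \sum_(a1 : A1) \sum_(a2 : A2) s1 a1 * s2 a2 * u a1 a2.

Definition best_resp1 (u1 : A1 -> A2 -> R) s1 s2 : Prop :=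
  mixed s1 /\ forall t1, mixed t1 -> eu u1 t1 s2 <= eu u1 s1 s2.
Definition best_resp2 (u2 : A1 -> A2 -> R) s1 s2 : Prop :=
  mixed s2 /\ forall t2, mixed t2 -> eu u2 s1 t2 <= eu u2 s1 s2.

Definition nash (u1 u2 : A1 -> A2 -> R) s1 s2 : Prop :=
  mixed s1 /\ mixed s2 /\ best_resp1 u1 s1 s2 /\ best_resp2 u2 s1 s2.

Definition V1 (u1 u2 : A1 -> A2 -> R) (v : R) : Prop :=
  exists s1 s2, nash u1 u2 s1 s2 /\ v = eu u1 s1 s2.
Definition V2 (u1 u2 : A1 -> A2 -> R) (v : R) : Prop :=
  exists s1 s2, nash u1 u2 s1 s2 /\ v = eu u2 s1 s2.

Definition card_gt1 (S : R -> Prop) : Prop := exists x y, S x /\ S y /\ x <> y.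
Definition card_eq1 (S : R -> Prop) : Prop := exists x, forall y, S y <-> y = x.

Definition history := seq (A1 * A2).
Definition behav (A : finType) := history -> {ffun A -> R}.
Definition is_behav (A : finType) (mu : behav A) : Prop := forall h, mixed (mu h).

Fixpoint rpay (u : A1 -> A2 -> R) (n : nat) (mu1 : behav A1) (mu2 : behav A2)
  (h : history) : R :=
  match n with
  | 0 => 0
  | n'.+1 => \sum_(a1 : A1) \sum_(a2 : A2)
       mu1 h a1 * mu2 h a2 * (u a1 a2 + rpay u n' mu1 mu2 (rcons h (a1, a2)))
  end.

Definition payoffT (u : A1 -> A2 -> R) (T : nat) mu1 mu2 : R := rpay u T mu1 mu2 [::].

Definition nashT (u1 u2 : A1 -> A2 -> R) (T : nat) (mu1 : behav A1) (mu2 : behav A2) : Prop :=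
  is_behav mu1 /\ is_behav mu2 /\
  (forall nu1 : behav A1, is_behav nu1 -> payoffT u1 T nu1 mu2 <= payoffT u1 T mu1 mu2) /\
  (forall nu2 : behav A2, is_behav nu2 -> payoffT u2 T mu1 nu2 <= payoffT u2 T mu1 mu2).

Definition cont (A : finType) (mu : behav A) (h : history) : behav A :=
  fun h' => mu (h ++ h').

Definition SPE (u1 u2 : A1 -> A2 -> R) (T : nat) (mu1 : behav A1) (mu2 : behav A2) : Prop :=
  forall (k : nat) (h : history), (k < T)%N -> size h = k ->
    nashT u1 u2 (T - k) (cont mu1 h) (cont mu2 h).

Definition locally_suboptimal (u1 u2 : A1 -> A2 -> R) (T : nat)
  (mu1 : behav A1) (mu2 : behav A2) : Prop :=
  exists (k : nat) (h : history), (k < T)%N /\ size h = k /\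
    ~ nash u1 u2 (mu1 h) (mu2 h).

End Games.

(* Main.v *)
(** Along a deepest history where the prescribed stage profile is not a stage
equilibrium, all later play consists of stage equilibria, so a player with a
unique equilibrium payoff has constant continuation payoffs there and must be
best responding in the stage game.

Conversely, it suffices to make a non-equilibrium profile optimal in the first
round by letting later stage equilibria depend on the realized actions. If both
players have two equilibrium payoffs, some pure profile is not an equilibrium,
and unilateral deviations from it are observable and can be punished. If only
player 1 has two, player 2 cannot be given incentives and must best respond.
Either some pure action of player 1 has a best reply of player 2 to which it is
not optimal, and player 1 is rewarded for that action; or every maximal entry of
a row of [u2] is an equilibrium payoff, hence equals the unique value [v], and
the value of player 2's best reply drops below [v] at the given mixture. Moving
towards a vertex of the polyhedron of pairs (mixture, upper bound on player 2's
payoffs) without raising the bound, one finds a mixture to which player 2 has at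
least as many pure best replies as player 1 has actions in the support. Pairing
support actions with distinct best replies and rewarding player 1 for a match,
one can solve for a mixture of player 2 which makes player 1 indifferent on the
support. The resulting profile gives player 2 less than [v], so it is no
equilibrium. *)

Require Import Defs.
From HB Require Import structures.
From mathcomp Require Import all_boot all_order all_algebra.
From mathcomp Require Import boolp reals.
From mathcomp Require Import ring lra.
Import Order.TTheory GRing.Theory Num.Theory.
Local Open Scope ring_scope.
Set Implicit Arguments. Unset Strict Implicit. Unset Printing Implicit Defensive.

(** Exchanges the players, so that facts about player 2 follow from those about player 1. *)
Definition transpose {R A1 A2 : Type} (u : A1 -> A2 -> R) : A2 -> A1 -> R :=
  fun b a => u a b.

(** * Expected payoffs and best responses in the stage game *)

Section StageGame.
Context {R : realType}.

Lemma sum_pure (A : finType) (a : A) (f : A -> R) :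
  \sum_b pure a b * f b = f a.
Proof.
rewrite (bigD1 a) //= ffunE eqxx mul1r big1 ?addr0 // => b /negbTE ba.
by rewrite ffunE ba mul0r.
Qed.

Lemma mixed_pure (A : finType) (a : A) : mixed (pure a : {ffun A -> R}).
Proof.
split=> [b|]; first by rewrite ffunE ler0n.
by rewrite -[RHS](sum_pure a (fun=> 1)); apply: eq_bigr => b _; rewrite mulr1.
Qed.

Lemma mixed_avg (A : finType) (s : {ffun A -> R}) c :
  mixed s -> \sum_a s a * c = c.
Proof. by case=> _ s1; rewrite -big_distrl /= s1 mul1r. Qed.

Lemma mixed_neq0 (A : finType) (s : {ffun A -> R}) :
  mixed s -> exists a, s a != 0.
Proof.
move=> [_ s1]; apply: contrapT => no; move: s1; rewrite big1 => [/eqP|a _].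
  by rewrite eq_sym oner_eq0.
by apply/eqP; apply: contrapT => /negP ?; apply: no; exists a.
Qed.

Lemma eu_transpose (A1 A2 : finType) (u : A1 -> A2 -> R) s1 s2 :
  eu (transpose u) s2 s1 = eu u s1 s2.
Proof.
rewrite /eu exchange_big; apply: eq_bigr => a _; apply: eq_bigr => b _.
by rewrite /transpose [s2 b * _]mulrC.
Qed.

Context {A1 A2 : finType}.
Implicit Types (u v : A1 -> A2 -> R).

Lemma eu_pure1 u a s2 : eu u (pure a) s2 = \sum_b s2 b * u a b.
Proof.
rewrite -(sum_pure a (fun a' => \sum_b s2 b * u a' b)); apply: eq_bigr => a' _.
by rewrite big_distrr; apply: eq_bigr => b _; rewrite /= mulrA.
Qed.

Lemma eu_avg1 u s1 s2 : eu u s1 s2 = \sum_a s1 a * eu u (pure a) s2.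
Proof.
apply: eq_bigr => a _; rewrite eu_pure1 big_distrr.
by apply: eq_bigr => b _; rewrite /= mulrA.
Qed.

End StageGame.

Section StageGameExpectation.
Context {R : realType} {A1 A2 : finType}.
Implicit Types (u v : A1 -> A2 -> R).

Lemma eu_pure2 u s1 b : eu u s1 (pure b) = \sum_a s1 a * u a b.
Proof. by rewrite -eu_transpose eu_pure1. Qed.

Lemma eu_avg2 u s1 s2 : eu u s1 s2 = \sum_b s2 b * eu u s1 (pure b).
Proof.
by rewrite -eu_transpose eu_avg1; apply: eq_bigr => b _; rewrite eu_transpose.
Qed.

Lemma eu_pure u a b : eu u (pure a) (pure b) = u a b.
Proof. by rewrite eu_pure1 sum_pure. Qed.

Lemma eu_add u v s1 s2 :
  eu (fun a b => u a b + v a b) s1 s2 = eu u s1 s2 + eu v s1 s2.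
Proof.
rewrite -big_split; apply: eq_bigr => a _; rewrite -big_split.
by apply: eq_bigr => b _; rewrite /= mulrDr.
Qed.

Lemma eu_cst (c : R) (s1 : {ffun A1 -> R}) (s2 : {ffun A2 -> R}) : 
  mixed s1 -> mixed s2 -> eu (fun _ _ => c) s1 s2 = c.
Proof.
move=> m1 m2; rewrite eu_avg1 -[RHS](mixed_avg c m1); apply: eq_bigr => a _.
by rewrite eu_pure1 mixed_avg.
Qed.

Lemma eu_le u v s1 s2 : mixed s1 -> mixed s2 ->
  (forall a b, u a b <= v a b) -> eu u s1 s2 <= eu v s1 s2.
Proof.
move=> [p1 _] [p2 _] uv; apply: ler_sum => a _; apply: ler_sum => b _.
by rewrite ler_wpM2l // mulr_ge0.
Qed.

Lemma eq_eu u v s1 s2 : (forall a b, u a b = v a b) -> eu u s1 s2 = eu v s1 s2.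
Proof.
by move=> uv; apply: eq_bigr => a _; apply: eq_bigr => b _; rewrite uv.
Qed.

Lemma mixed_avg_le (A : finType) (s : {ffun A -> R}) (f : A -> R) c :
  mixed s -> (forall a, f a <= c) -> \sum_a s a * f a <= c.
Proof.
move=> ms fc; rewrite -[leRHS](mixed_avg c ms); apply: ler_sum => a _.
by rewrite ler_wpM2l //; case: ms.
Qed.

Lemma mixed_avg_eq (A : finType) (s : {ffun A -> R}) (f : A -> R) c :
  mixed s -> (forall a, s a != 0 -> f a = c) -> \sum_a s a * f a = c.
Proof.
move=> ms fc; rewrite -[RHS](mixed_avg c ms); apply: eq_bigr => a _.
by have [->|/fc ->] := eqVneq (s a) 0; rewrite ?mul0r.
Qed.

(** The weighted gaps [s a * (c - f a)] are nonnegative and sum to zero, so each vanishes. *)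
Lemma mixed_avg_max (A : finType) (s : {ffun A -> R}) (f : A -> R) c :
  mixed s -> (forall a, f a <= c) -> \sum_a s a * f a = c ->
  forall a, s a != 0 -> f a = c.
Proof.
move=> ms fc; rewrite -[RHS](mixed_avg c ms) => /eqP.
rewrite eq_sym -subr_eq0 -sumrB psumr_eq0 => [/allP z a sa|a _]; last first.
  by rewrite subr_ge0 ler_wpM2l //; case: ms.
have /z : a \in index_enum A by exact: mem_index_enum.
by rewrite /= -mulrBr mulf_eq0 (negbTE sa) subr_eq0 => /eqP ->.
Qed.

Lemma best_resp1P u s1 s2 :
  best_resp1 u s1 s2 <->
  mixed s1 /\ forall a, eu u (pure a) s2 <= eu u s1 s2.
Proof.
split=> -[m1 le1]; split=> //; first by move=> a; apply/le1/mixed_pure.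
by move=> t1 mt; rewrite eu_avg1; apply: mixed_avg_le.
Qed.

Lemma best_resp1_supp u s1 s2 c : mixed s1 ->
  (forall a, eu u (pure a) s2 <= c) ->
  (forall a, s1 a != 0 -> eu u (pure a) s2 = c) -> best_resp1 u s1 s2.
Proof.
move=> m1 le1 eq1; apply/best_resp1P; split=> // a.
by rewrite [leRHS]eu_avg1 (mixed_avg_eq m1 eq1).
Qed.

Lemma best_resp1_addc u c s1 s2 : mixed s2 ->
  best_resp1 (fun a b => u a b + c) s1 s2 <-> best_resp1 u s1 s2.
Proof.
move=> m2; split=> -[m1 le1]; split=> // t1 mt; have := le1 _ mt.
  by rewrite !(eu_add u (fun=> fun=> c)) !eu_cst // lerD2r.
by rewrite !(eu_add u (fun=> fun=> c)) !eu_cst // lerD2r.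
Qed.

End StageGameExpectation.

Section BestResponse.
Context {R : realType} {A1 A2 : finType}.
Implicit Types (u v : A1 -> A2 -> R).

Lemma best_resp1_transpose u s1 s2 :
  best_resp1 (transpose u) s2 s1 <-> best_resp2 u s1 s2.
Proof.
split=> -[m2 le2]; split=> // t2 mt; have := le2 _ mt;
by rewrite !(eu_transpose u).
Qed.

Lemma best_resp2_transpose u s1 s2 :
  best_resp2 (transpose u) s2 s1 <-> best_resp1 u s1 s2.
Proof.
split=> -[m1 le1]; split=> // t1 mt; have := le1 _ mt;
by rewrite !(eu_transpose u).
Qed.

Lemma best_resp2P u s1 s2 :
  best_resp2 u s1 s2 <->
  mixed s2 /\ forall b, eu u s1 (pure b) <= eu u s1 s2.
Proof.
rewrite -best_resp1_transpose best_resp1P.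
by split=> -[m2 le2]; split=> // b; have := le2 b; rewrite !(eu_transpose u).
Qed.

Lemma best_resp2_addc u c s1 s2 : mixed s1 ->
  best_resp2 (fun a b => u a b + c) s1 s2 <-> best_resp2 u s1 s2.
Proof.
move=> m1; rewrite -!best_resp1_transpose.
exact: (best_resp1_addc (transpose u)).
Qed.

Lemma nash_best_resp (u1 u2 : A1 -> A2 -> R) s1 s2 :
  best_resp1 u1 s1 s2 -> best_resp2 u2 s1 s2 -> nash u1 u2 s1 s2.
Proof. by move=> b1 b2; split; [case: b1|split; [case: b2|]]. Qed.

Lemma nash_transpose (u1 u2 : A1 -> A2 -> R) s1 s2 :
  nash (transpose u2) (transpose u1) s2 s1 <-> nash u1 u2 s1 s2.
Proof.
rewrite /nash best_resp1_transpose best_resp2_transpose.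
by split=> -[? [? [? ?]]].
Qed.

Lemma eq_nash (u1 u2 v1 v2 : A1 -> A2 -> R) s1 s2 :
  (forall a b, u1 a b = v1 a b) -> (forall a b, u2 a b = v2 a b) ->
  nash u1 u2 s1 s2 -> nash v1 v2 s1 s2.
Proof.
move=> e1 e2 [m1 [m2 [[_ b1] [_ b2]]]]; apply: nash_best_resp; split=> //.
  by move=> t1 /b1; rewrite !(eq_eu _ _ e1).
by move=> t2 /b2; rewrite !(eq_eu _ _ e2).
Qed.

Lemma nash_addc (u1 u2 : A1 -> A2 -> R) c1 c2 s1 s2 :
  nash (fun a b => u1 a b + c1) (fun a b => u2 a b + c2) s1 s2 <->
  nash u1 u2 s1 s2.
Proof.
split=> -[m1 [m2 [b1 b2]]]; apply: nash_best_resp.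
- exact/(best_resp1_addc u1 c1).
- exact/(best_resp2_addc u2 c2).
- exact/(best_resp1_addc u1 c1).
- exact/(best_resp2_addc u2 c2).
Qed.

End BestResponse.

(** * Linear systems and the ratio test *)

Section LinearAlgebra.
Context {R : realFieldType}.

(** With fewer columns ([Y]) than rows ([I]), the rows are linearly dependent. *)
Lemma kernel_vector (I J : finType) (Y : {set J}) (E : I -> J -> R) :
  (#|Y| < #|I|)%N ->
  exists d : I -> R, (exists i, d i != 0) /\
    (forall y, y \in Y -> \sum_i d i * E i y = 0).
Proof.
move=> YI.
pose M := \matrix_(i < #|I|, j < #|Y|) E (enum_val i) (enum_val j).
have : ~~ row_free M.
  by rewrite /row_free neq_ltn (leq_ltn_trans (rank_leq_col M) YI).
rewrite -kermx_eq0 => /rowV0Pn[v /sub_kermxP vM v0].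
exists (fun i => v 0 (enum_rank i)); split.
  have /rV0Pn[j vj] := v0.
  by exists (enum_val j); rewrite enum_valK.
move=> y yY; have := congr1 (fun N : 'rV_(_) => N 0 (enum_rank_in yY y)) vM.
rewrite !mxE (reindex _ (onW_bij _ (enum_val_bij I))) => {2}<-.
apply: eq_bigr => j _; rewrite enum_valK mxE enum_rankK_in //.
Qed.

(* An M-matrix argument: the equation at the index where [x] is minimal forces
   that minimum to be nonnegative. *)
Lemma dominant_ge0 (I : finType) (P : I -> I -> R) (lam c : R) (x : I -> R) :
  (forall a b, 0 <= P a b) -> (forall a, \sum_b P a b < lam) ->
  (forall a, lam * x a = c + \sum_b P a b * x b) ->
  0 <= c -> forall a, c <= lam * x a.
Proof.
move=> P0 Plam xE c0 a0.
have [i _ xi] : exists2 i, true & forall a, x i <= x a.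
  case: (@Order.TotalTheory.arg_minP _ _ _ a0 predT x isT) => i _ h.
  by exists i => // a; apply: h.
have xi0 : 0 <= x i.
  rewrite -(pmulr_rge0 _ (_ : 0 < lam - \sum_b P i b)) ?subr_gt0 //.
  rewrite mulrBl xE -addrA addr_ge0 // subr_ge0 mulr_suml.
  by apply: ler_sum => b _; rewrite ler_wpM2l.
rewrite xE lerDl sumr_ge0 // => b _.
by rewrite mulr_ge0 // (le_trans xi0).
Qed.

(** [dominant_ge0] with [c = 0], applied to a kernel vector and its negative, gives invertibility;
    with [c = 1] it gives positivity of the solution. *)
Lemma dominant_solution (I : finType) (P : I -> I -> R) (lam : R) :
  (forall a b, 0 <= P a b) -> (forall a, \sum_b P a b < lam) ->
  exists x : I -> R, (forall a, 0 < x a) /\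
    (forall a, lam * x a = 1 + \sum_b P a b * x b).
Proof.
move=> P0 Plam.
have lam0 (a : I) : 0 < lam by apply: le_lt_trans (Plam a); exact: sumr_ge0.
pose E a b := lam * (a == b)%:R - P a b.
pose M := \matrix_(i < #|I|, j < #|I|) E (enum_val j) (enum_val i).
have ME (x : 'rV_#|I|) (a : I) : (x *m M) 0 (enum_rank a) =
    lam * x 0 (enum_rank a) - \sum_b P a b * x 0 (enum_rank b).
  transitivity (\sum_b E a b * x 0 (enum_rank b)).
    rewrite mxE [RHS](reindex _ (onW_bij _ (enum_val_bij I))).
    by apply: eq_bigr => j _; rewrite mxE enum_rankK /= enum_valK mulrC.
  under eq_bigr => b _ do rewrite mulrBl; rewrite sumrB; congr (_ - _).
  rewrite (bigD1 a) //= eqxx mulr1 big1 ?addr0 // => b ba.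
  by rewrite eq_sym (negbTE ba) mulr0 mul0r.
have Munit : M \in unitmx.
  rewrite -row_free_unit; apply: inj_row_free => x xM.
  have xE (a : I) : lam * x 0 (enum_rank a) = 0 + \sum_b P a b * x 0 (enum_rank b).
    by apply/eqP; rewrite add0r -subr_eq0 -ME xM mxE.
  have xN (a : I) : lam * - x 0 (enum_rank a) = 0 + \sum_b P a b * - x 0 (enum_rank b).
    rewrite mulrN xE !add0r -sumrN; apply: eq_bigr => b _; exact/esym/mulrN.
  apply/rowP => j; rewrite mxE -(enum_valK j); set a := enum_val j.
  have := dominant_ge0 P0 Plam xE (lexx 0) a.
  have := dominant_ge0 P0 Plam xN (lexx 0) a.
  rewrite !pmulr_rge0 ?lam0 // oppr_ge0 => x0 x0'.
  by apply/le_anti/andP.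
pose x := const_mx 1 *m invmx M : 'rV_#|I|.
have xE (a : I) : lam * x 0 (enum_rank a) = 1 + \sum_b P a b * x 0 (enum_rank b).
  by apply/eqP; rewrite -subr_eq -ME mulmxKV // mxE.
exists (fun a => x 0 (enum_rank a)); split=> [a|]; last exact: xE.
have := dominant_ge0 P0 Plam xE ler01 a.
by move/(lt_le_trans ltr01); rewrite pmulr_rgt0 ?(lam0 a).
Qed.

(** As in the simplex method, [t] is the least ratio [al i / - be i] over the indices with
    [be i < 0]: the moment when a first coordinate reaches zero. *)
Lemma ratio_test (I : finType) (al be : I -> R) :
  (forall i, 0 <= al i) -> (forall i, al i = 0 -> be i = 0) ->
  (exists i, be i < 0) ->
  exists t, [/\ 0 < t, forall i, 0 <= al i + t * be i &
    exists2 i, al i != 0 & al i + t * be i = 0].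
Proof.
move=> al0 albe [i0 bi0].
case: (@Order.TotalTheory.arg_minP _ _ _ i0 (fun i => be i < 0)
  (fun i => al i / - be i) bi0) => i bi imin.
have ai : al i != 0 by apply: contraTneq bi => /albe ->; rewrite ltxx.
have ti : 0 < al i / - be i.
  by rewrite divr_gt0 ?oppr_gt0 // lt_neqAle eq_sym ai al0.
exists (al i / - be i); split=> // [k|].
  have [bk|bk] := ltP (be k) 0; last first.
    by rewrite addr_ge0 // mulr_ge0 // ltW.
  have := imin _ bk; rewrite ler_pdivlMr ?oppr_gt0 //.
  by rewrite mulrN -subr_ge0 opprK.
exists i => //.
by rewrite invrN mulrN mulNr divfK ?subrr // lt_eqF.
Qed.

End LinearAlgebra.

(** * Vertices of the polyhedron of mixtures with a payoff bound *)

Section Vertex.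
Context {R : realType} {A1 A2 : finType}.
Variable u : A1 -> A2 -> R.

(* The constraints [s a >= 0] and [eu u s (pure b) <= w] on a point [(s, w)],
   as nonnegativity of slack variables. *)
Let slack (s : {ffun A1 -> R}) (w : R) (i : A1 + A2) : R :=
  match i with inl a => s a | inr b => w - \sum_a s a * u a b end.

Let tight s w := [set i | slack s w i == 0].

(** The unknowns [d], [t] have [#|A1| + 1] coordinates, while the tight constraints and the zero sum
    give at most [#|A1|] equations. Negating a solution if necessary makes [t <= 0]. *)
Lemma tight_direction s w : (#|tight s w| < #|A1|)%N ->
  exists (d : {ffun A1 -> R}) (t : R),
    [/\ t <= 0, \sum_a d a = 0, t != 0 \/ exists a, d a != 0 &
        forall i, slack s w i = 0 -> slack d t i = 0].
Proof.
move=> Zlt.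
suff [d [t [dsum d0 dZ]]] : exists (d : {ffun A1 -> R}) (t : R),
    [/\ \sum_a d a = 0, t != 0 \/ exists a, d a != 0 &
        forall i, slack s w i = 0 -> slack d t i = 0].
  have [t0|/ltW t0] := leP t 0; first by exists d, t.
  exists [ffun a => - d a], (- t); split; first by rewrite oppr_le0.
  - under eq_bigr => a _ do rewrite ffunE.
    by rewrite sumrN dsum oppr0.
  - case: d0 => [|[a da]]; [by left; rewrite oppr_eq0|right].
    by exists a; rewrite ffunE oppr_eq0.
  - move=> i /dZ; case: i => [a|b] /= z; first by rewrite ffunE z oppr0.
    under eq_bigr => a _ do rewrite ffunE mulNr.
    by rewrite sumrN -opprD z oppr0.
(* Column [None] encodes the zero sum, the others the slacks; row [inr tt] belongs to [t]. *)
pose E (i : A1 + unit) (j : option (A1 + A2)) : R :=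
  match j, i with
  | None, inl _ => 1 | None, inr _ => 0
  | Some (inl a'), inl a => (a == a')%:R | Some (inl _), inr _ => 0
  | Some (inr b), inl a => - u a b | Some (inr _), inr _ => 1
  end.
have [|x [[i xi] xE]] := @kernel_vector R _ _ (None |: Some @: tight s w) E.
  rewrite card_sum card_unit addn1 ltnS (leq_trans (leq_card_setU _ _).1) //.
  by rewrite cards1 card_imset // => ? ? [].
exists [ffun a => x (inl a)], (x (inr tt)); split.
- have := xE None (setU11 _ _); rewrite big_sumType /= [X in _ + X]big1 => [|[] _].
    by rewrite addr0 => {2}<-; apply: eq_bigr => a _; rewrite ffunE mulr1.
  by rewrite mulr0.
- by case: i xi => [a|[]] xi; [right; exists a; rewrite ffunE|left].
- move=> j jz; have := xE (Some j); rewrite in_setU1 imset_f ?inE ?jz //= => /(_ isT).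
  rewrite big_sumType /= (bigD1 tt) //= [X in _ + (_ + X)]big1 => [|[]//].
  rewrite addr0; case: j jz => [a|b] _ /=.
    rewrite ffunE mulr0 addr0 (bigD1 a) //= eqxx mulr1 big1 ?addr0 // => a' /negbTE ->.
    by rewrite mulr0.
  rewrite mulr1 addrC => eq0; apply: etrans eq0; congr (_ + _); rewrite -sumrN.
  by apply: eq_bigr => a _; rewrite ffunE mulrN.
Qed.

(** Induction on the number of constraints that are not tight. If at least [#|A1|] are tight, zero
    weights and replies attaining the bound together number at least [#|A1|], which is the claim.
    Otherwise one moves along [tight_direction] until another constraint becomes tight. *)
Lemma vertex_le s w (b0 : A2) : mixed s ->
  (forall b, eu u s (pure b) <= w) ->
  exists s' w', [/\ mixed s', w' <= w, forall b, eu u s' (pure b) <= w' &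
    (#|[set a | s' a != 0%R]| <= #|[set b | eu u s' (pure b) == w']|)%N].
Proof.
have [n] := ubnP (#|{: A1 + A2}| - #|tight s w|).
elim: n s w => // n IHn s w ltn ms le_w.
have sl0 i : 0 <= slack s w i.
  by case: i => [a|b] /=; [case: ms|rewrite subr_ge0 -eu_pure2].
have [Zge|Zlt] := leqP #|A1| #|tight s w|.
  exists s, w; split=> //; move: Zge.
  have -> : #|tight s w| =
      (#|~: [set a | s a != 0%R]| + #|[set b | eu u s (pure b) == w]|)%N.
    rewrite -!sum1_card big_sumType; congr addn; apply: eq_bigl => i.
      by rewrite !inE negbK.
    by rewrite !inE /= subr_eq0 eu_pure2 eq_sym.
  by rewrite -(cardsC [set a | s a != 0]) addnC leq_add2l.
have [d [t [t0 dsum dt dZ]]] := tight_direction Zlt.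
(* If no weight decreases, the zero sum forces [d = 0]; then [t < 0] and the slack of [b0]
   decreases. *)
have [i0 neg] : exists i, slack d t i < 0.
  have [[a da]|all0] := pselect (exists a, d a < 0); first by exists (inl a).
  have d0 a : d a = 0.
    move/eqP: dsum; rewrite psumr_eq0 => [/allP/(_ a)|a' _].
      by rewrite mem_index_enum => /(_ isT)/eqP.
    by rewrite leNgt; apply/negP => ?; apply: all0; exists a'.
  exists (inr b0); rewrite /= big1 => [|a _]; last by rewrite d0 mul0r.
  by rewrite subr0 lt_neqAle t0 andbT; case: dt => // -[a]; rewrite d0 eqxx.
have [tau [tau0 ge0 [i iNZ i0']]] :=
  ratio_test sl0 dZ (ex_intro _ i0 neg).
pose s' := [ffun a => s a + tau * d a]; pose w' := w + tau * t.
have slE k : slack s' w' k = slack s w k + tau * slack d t k.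
  case: k => [a|b] /=; first by rewrite ffunE.
  under eq_bigr => a _ do rewrite ffunE mulrDl -mulrA.
  by rewrite big_split /= -mulr_sumr /w' mulrBr opprD addrACA.
have ms' : mixed s'.
  split=> [a|]; first by have := ge0 (inl a); rewrite -slE.
  under eq_bigr => a _ do rewrite ffunE.
  by rewrite big_split /= -mulr_sumr dsum mulr0 addr0; case: ms.
have le_w' b : eu u s' (pure b) <= w'.
  by rewrite eu_pure2 -subr_ge0; have := ge0 (inr b); rewrite -slE.
have [|s'' [w'' [? le'' ? ?]]] := IHn s' w' _ ms' le_w'; last first.
  by exists s'', w''; split=> //; rewrite (le_trans le'') // gerDl pmulr_rle0.
have ZZ : tight s w \proper tight s' w'.
  apply/properP; split.
    by apply/subsetP => k; rewrite !inE slE => /eqP z; rewrite z dZ // mulr0 addr0.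
  by exists i; rewrite !inE ?slE ?i0'.
move: (proper_card ZZ) (max_card (mem (tight s' w'))) ltn => {IHn}.
set x := #|tight s w|; set y := #|_|; set z := #|_|; clearbody x y z.
move=> xy yz; rewrite !ltnS; apply: leq_trans.
by apply: ltn_sub2l => //; apply: leq_trans xy yz.
Qed.

End Vertex.

(** * The repeated game: one-shot deviations and sustainable profiles *)

Section RepeatedGame.
Context {R : realType} {A1 A2 : finType}.
Implicit Types (u : A1 -> A2 -> R) (h : @history A1 A2).

Local Notation behav1 := (@behav R A1 A2 A1).
Local Notation behav2 := (@behav R A1 A2 A2).

(** The game faced at [h] when [n] more rounds follow the current one, with the continuation payoff
    folded into the stage payoff. *)
Definition aux_game u n (mu1 : behav1) (mu2 : behav2) h (a : A1) (b : A2) : R :=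
  u a b + rpay u n mu1 mu2 (rcons h (a, b)).

Lemma rpayS u n (mu1 : behav1) (mu2 : behav2) h :
  rpay u n.+1 mu1 mu2 h = eu (aux_game u n mu1 mu2 h) (mu1 h) (mu2 h).
Proof. by []. Qed.

(** Two histories are compared because a continuation strategy restarts at the empty history. *)
Lemma eq_rpay u n (mu1 nu1 : behav1) (mu2 nu2 : behav2) h g :
  (forall h', mu1 (h ++ h') = nu1 (g ++ h')) ->
  (forall h', mu2 (h ++ h') = nu2 (g ++ h')) ->
  rpay u n mu1 mu2 h = rpay u n nu1 nu2 g.
Proof.
elim: n h g => // n IHn h g e1 e2; rewrite !rpayS.
have := e1 [::]; have := e2 [::]; rewrite !cats0 => -> ->.
apply: eq_eu => a b; congr (_ + _).
by apply: IHn => h'; rewrite !cat_rcons.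
Qed.

Lemma rpay_cont_dev1 u n (nu1 : behav1) (mu2 : behav2) h :
  payoffT u n nu1 (cont mu2 h) = rpay u n (fun g => nu1 (drop (size h) g)) mu2 h.
Proof. by apply: eq_rpay => h' //=; rewrite drop_size_cat. Qed.

Lemma rpay_cont_dev2 u n (mu1 : behav1) (nu2 : behav2) h :
  payoffT u n (cont mu1 h) nu2 = rpay u n mu1 (fun g => nu2 (drop (size h) g)) h.
Proof. by apply: eq_rpay => h' //=; rewrite drop_size_cat. Qed.

Lemma rpay_cont u n (mu1 : behav1) (mu2 : behav2) h :
  payoffT u n (cont mu1 h) (cont mu2 h) = rpay u n mu1 mu2 h.
Proof. exact: eq_rpay. Qed.

(** Backward induction. The hypothesis covers all histories shorter than [size h + n], so that it
    passes unchanged to [rcons h (a, b)]; the subtraction counts the rounds after [h']. *)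
Lemma rpay_dev_le1 u n (mu1 : behav1) (mu2 : behav2) h :
  is_behav mu2 ->
  (forall h', (size h' < size h + n)%N -> best_resp1
    (aux_game u (size h + n - (size h').+1) mu1 mu2 h') (mu1 h') (mu2 h')) ->
  forall nu1 : behav1, is_behav nu1 -> rpay u n nu1 mu2 h <= rpay u n mu1 mu2 h.
Proof.
move=> m2 + nu1 mn; elim: n h => // n IHn h br; rewrite !rpayS.
have := br h; rewrite addnS ltnS leq_addr subSS addKn => /(_ isT)[_ brh].
apply: le_trans (brh _ (mn h)); apply: eu_le => // a b.
rewrite lerD2l; apply: IHn => h'.
by rewrite size_rcons addSnnS; apply: br.
Qed.

Lemma rpay_dev_le2 u n (mu1 : behav1) (mu2 : behav2) h :
  is_behav mu1 ->
  (forall h', (size h' < size h + n)%N -> best_resp2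
    (aux_game u (size h + n - (size h').+1) mu1 mu2 h') (mu1 h') (mu2 h')) ->
  forall nu2 : behav2, is_behav nu2 -> rpay u n mu1 nu2 h <= rpay u n mu1 mu2 h.
Proof.
move=> m1 + nu2 mn; elim: n h => // n IHn h br; rewrite !rpayS.
have := br h; rewrite addnS ltnS leq_addr subSS addKn => /(_ isT)[_ brh].
apply: le_trans (brh _ (mn h)); apply: eu_le => // a b.
rewrite lerD2l; apply: IHn => h'.
by rewrite size_rcons addSnnS; apply: br.
Qed.

Lemma one_shot_deviation u1 u2 T (mu1 : behav1) (mu2 : behav2) :
  is_behav mu1 -> is_behav mu2 ->
  (forall h, (size h < T)%N ->
     nash (aux_game u1 (T - (size h).+1) mu1 mu2 h)
          (aux_game u2 (T - (size h).+1) mu1 mu2 h) (mu1 h) (mu2 h)) ->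
  SPE u1 u2 T mu1 mu2.
Proof.
move=> m1 m2 st k h kT hk; split; first by move=> h'; exact: m1.
split; first by move=> h'; exact: m2.
have hT : (size h + (T - k))%N = T by rewrite hk subnKC // ltnW.
split=> nu mn.
  rewrite rpay_cont rpay_cont_dev1; apply: rpay_dev_le1 => // h'.
  by rewrite hT => /st[_ [_ []]].
rewrite rpay_cont rpay_cont_dev2; apply: rpay_dev_le2 => // h'.
by rewrite hT => /st[_ [_ []]].
Qed.

Lemma SPE_nash_aux_game u1 u2 T (mu1 : behav1) (mu2 : behav2) h :
  SPE u1 u2 T mu1 mu2 -> (size h < T)%N ->
  nash (aux_game u1 (T - (size h).+1) mu1 mu2 h)
       (aux_game u2 (T - (size h).+1) mu1 mu2 h) (mu1 h) (mu2 h).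
Proof.
move=> spe hT; have [m1 [m2 [d1 d2]]] := spe _ h hT erefl.
have mu1h := m1 [::]; have mu2h := m2 [::]; move: mu1h mu2h.
rewrite /cont !cats0 => mu1h mu2h.
apply: nash_best_resp; split=> // t mt.
  (* The deviation plays [t] now and returns to the prescribed strategy afterwards. *)
  pose nu : behav1 := fun g => if g is [::] then t else cont mu1 h g.
  have mnu : is_behav nu by case=> // ab g; exact: m1.
  have := d1 nu mnu; rewrite rpay_cont -(subnSK hT) rpayS; congr (_ <= _).
  rewrite /payoffT rpayS /cont cats0; apply: eq_eu => a b; congr (_ + _).
  by apply: eq_rpay => h' //=; rewrite cat_rcons.
pose nu : behav2 := fun g => if g is [::] then t else cont mu2 h g.
have mnu : is_behav nu by case=> // ab g; exact: m2.
have := d2 nu mnu; rewrite rpay_cont -(subnSK hT) rpayS; congr (_ <= _).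
rewrite /payoffT rpayS /cont cats0; apply: eq_eu => a b; congr (_ + _).
by apply: eq_rpay => h' //=; rewrite cat_rcons.
Qed.

Lemma rpay_stage_cst u v n (mu1 : behav1) (mu2 : behav2) h :
  is_behav mu1 -> is_behav mu2 ->
  (forall h', (size h <= size h' < size h + n)%N -> eu u (mu1 h') (mu2 h') = v) ->
  rpay u n mu1 mu2 h = v *+ n.
Proof.
move=> m1 m2; elim: n h => // n IHn h st; rewrite rpayS eu_add st; last first.
  by rewrite leqnn addnS ltnS leq_addr.
rewrite mulrS; congr (_ + _); rewrite -[RHS](eu_cst (v *+ n) (m1 h) (m2 h)).
apply: eq_eu => a b; apply: IHn => h'.
rewrite size_rcons addSnnS => /andP[/ltnW le1 lt2]; apply: st.
by rewrite le1.
Qed.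

(* A profile that is an equilibrium of the first round when each realized
   action pair [(a, b)] is followed by [N] rounds of the stage equilibria
   [P a b i], played irrespective of later observations. *)
Definition sustainable u1 u2 s1 s2 : Prop :=
  exists (N : nat) (P : A1 -> A2 -> nat -> {ffun A1 -> R} * {ffun A2 -> R}),
    (forall a b i, nash u1 u2 (P a b i).1 (P a b i).2) /\
    nash (fun a b => u1 a b + \sum_(i < N) eu u1 (P a b i).1 (P a b i).2)
         (fun a b => u2 a b + \sum_(i < N) eu u2 (P a b i).1 (P a b i).2) s1 s2.

Lemma sustainable_SPE u1 u2 s1 s2 :
  sustainable u1 u2 s1 s2 -> ~ nash u1 u2 s1 s2 ->
  exists T (mu1 : behav1) (mu2 : behav2),
    (1 <= T)%N /\ SPE u1 u2 T mu1 mu2 /\ locally_suboptimal u1 u2 T mu1 mu2.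
Proof.
move=> [N [P [Pn s12]]] nn.
(* Later play depends only on the first action pair and the number of rounds since. *)
pose mu1 : behav1 := fun h => if h is (a, b) :: h' then (P a b (size h')).1 else s1.
pose mu2 : behav2 := fun h => if h is (a, b) :: h' then (P a b (size h')).2 else s2.
have m1 : is_behav mu1 by case=> [|[a b] h]; [case: s12 | case: (Pn a b (size h))].
have m2 : is_behav mu2.
  by case=> [|[a b] h]; [case: s12 => _ [] | case: (Pn a b (size h)) => _ []].
have rpayE u n a b h : rpay u n mu1 mu2 ((a, b) :: h) =
    \sum_(i < n) eu u (P a b (size h + i)%N).1 (P a b (size h + i)%N).2.
  elim: n h => [|n IHn] h; first by rewrite big_ord0.
  rewrite rpayS eu_add big_ord_recl /= addn0; congr (_ + _).
  rewrite -[RHS](eu_cst _ (m1 ((a, b) :: h)) (m2 ((a, b) :: h))).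
  apply: eq_eu => a' b' /=; rewrite IHn; apply: eq_bigr => i _.
  by rewrite size_rcons addSnnS.
exists N.+1, mu1, mu2; split=> //; split; last by exists 0, [::].
apply: one_shot_deviation => // -[|[a b] h] hN.
  apply: eq_nash s12 => a b; rewrite /aux_game subn1 /= rpayE //.
set n := (_ - _)%N; have := Pn a b (size h).
(* After the first round the continuation payoff is this constant whatever is played now, so stage
   equilibria remain equilibria. *)
pose c u :=
  \sum_(i < n) eu u (P a b ((size h).+1 + i)%N).1 (P a b ((size h).+1 + i)%N).2.
move/(nash_addc _ _ (c u1) (c u2)); apply: eq_nash => a' b';
by rewrite /aux_game rcons_cons rpayE size_rcons.
Qed.

End RepeatedGame.

Section SustainableTranspose.
Context {R : realType} {A1 A2 : finType}.

Lemma sustainable_transpose (u1 u2 : A1 -> A2 -> R) s1 s2 :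
  sustainable (transpose u2) (transpose u1) s2 s1 -> sustainable u1 u2 s1 s2.
Proof.
move=> [N [P [Pn s12]]].
exists N, (fun a b i => ((P b a i).2, (P b a i).1)); split.
  by move=> a b i; apply: (iffLR (nash_transpose _ _ _ _)); exact: Pn.
apply: (iffLR (nash_transpose _ _ _ _)); apply: eq_nash s12 => b a; rewrite /transpose;
congr (_ + _); by apply: eq_bigr => i _; rewrite -eu_transpose.
Qed.

End SustainableTranspose.

(** * Archimedean bounds, injections and split sums *)

Section Bounds.
Context {R : realType}.

Lemma mulrn_archi (g c : R) : 0 < g -> exists n : nat, c < g *+ n.
Proof.
move=> g0; exists (Num.truncn (c / g)).+1.
by rewrite -mulr_natl -ltr_pdivrMr // truncnS_gt.
Qed.

Lemma finite_bound (A1 A2 : finType) (u : A1 -> A2 -> R) :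
  exists C, forall a b, `|u a b| <= C.
Proof.
exists (\sum_a \sum_b `|u a b|) => a b.
rewrite (bigD1 a) //= (bigD1 b) //= -addrA lerDl addr_ge0 //.
  by apply: sumr_ge0.
by apply: sumr_ge0 => ? _; apply: sumr_ge0.
Qed.

Lemma card_gt1_lt (S : R -> Prop) :
  card_gt1 S -> exists x y, [/\ S x, S y & x < y].
Proof.
move=> [x [y [Sx [Sy /eqP]]]]; rewrite neq_lt => /orP[xy|yx].
  by exists x, y.
by exists y, x.
Qed.

Lemma card_gt1_or_eq1 (S : R -> Prop) x : S x -> card_gt1 S \/ card_eq1 S.
Proof.
move=> Sx; have [|all_eq] := pselect (card_gt1 S); first by left.
right; exists x => y; split=> [Sy|->//].
by apply: contrapT => yx; apply: all_eq; exists y, x.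
Qed.

(** Elements are matched by their positions in the two enumerations; nonemptiness of [F] supplies
    the default [y0]. *)
Lemma set_injection (A1 A2 : finType) (F : {set A1}) (Y : {set A2}) :
  F != set0 -> (#|F| <= #|Y|)%N ->
  exists j : A1 -> A2, {in F &, injective j} /\ {in F, forall a, j a \in Y}.
Proof.
rewrite -card_gt0 => F0 FY.
have /card_gt0P[y0 _] : (0 < #|Y|)%N by exact: leq_trans FY.
have idx a : a \in F -> (index a (enum F) < size (enum Y))%N.
  move=> aF; rewrite -cardE; apply: leq_trans FY.
  by rewrite cardE index_mem mem_enum.
exists (fun a => nth y0 (enum Y) (index a (enum F))); split.
  move=> a b aF bF /eqP; rewrite nth_uniq ?idx ?enum_uniq // => /eqP ab.
  have := congr1 (nth a (enum F)) ab.
  by rewrite !nth_index ?mem_enum.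
by move=> a aF; rewrite -mem_enum mem_nth ?idx.
Qed.

Lemma sum_prefix (T : Type) (m n : nat) (X Y : T) (f : T -> R) :
  \sum_(i < m + n) f (if (i < m)%N then X else Y) = f X *+ m + f Y *+ n.
Proof.
rewrite big_split_ord /=; congr (_ + _).
  rewrite -[m in RHS](card_ord m) -sumr_const; apply: eq_bigr => i _.
  by rewrite ltn_ord.
rewrite -[n in RHS](card_ord n) -sumr_const; apply: eq_bigr => i _.
by rewrite ltnNge leq_addr.
Qed.

End Bounds.

(** * Sustaining profiles that are not stage equilibria *)

Section PureBestResponses.
Context {R : realType} {A1 A2 : finType}.
Implicit Types (u : A1 -> A2 -> R).

(** If every pure action is optimal against every pure reply, [u] does not depend on player 1's
    action. *)
Lemma best_resp1_all_pure u s1 s2 :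
  (forall a b, best_resp1 u (pure a) (pure b)) -> mixed s1 -> best_resp1 u s1 s2.
Proof.
move=> brp m1.
have cst a a' : eu u (pure a) s2 = eu u (pure a') s2.
  have le b x y : u x b <= u y b.
    by have [_ /(_ x)] := (best_resp1P _ _ _).1 (brp y b); rewrite !eu_pure.
  rewrite !eu_pure1; apply: eq_bigr => b _; congr (_ * _).
  by apply/le_anti; rewrite !le.
apply/best_resp1P; split=> // a; rewrite [leRHS]eu_avg1.
by rewrite (mixed_avg_eq m1 (fun a' _ => cst a' a)).
Qed.

End PureBestResponses.

Section Sustainability.
Context {R : realType} {A1 A2 : finType}.
Implicit Types (u : A1 -> A2 -> R).

Lemma pure_not_nash (u1 u2 : A1 -> A2 -> R) s1 s2 :
  mixed s1 -> mixed s2 -> ~ nash u1 u2 s1 s2 ->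
  exists a b, ~ nash u1 u2 (pure a) (pure b).
Proof.
move=> m1 m2 nn; apply: contrapT => np; apply: nn.
have pn a b : nash u1 u2 (pure a) (pure b).
  by apply: contrapT => nab; apply: np; exists a, b.
apply: nash_best_resp.
  by apply: best_resp1_all_pure => // a b; case: (pn a b) => _ [_ []].
apply/best_resp1_transpose/best_resp1_all_pure => // b a.
by apply/best_resp1_transpose; case: (pn a b) => _ [_ []].
Qed.

(* On the path, [m] rounds of player 1's preferred equilibrium and then [m] of
   player 2's; a unilateral deviation replaces the deviator's block by [m]
   rounds of an equilibrium that is worse for the deviator. *)
Lemma sustainable_pure (u1 u2 : A1 -> A2 -> R) a b :
  card_gt1 (V1 u1 u2) -> card_gt1 (V2 u1 u2) ->
  sustainable u1 u2 (pure a) (pure b).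
Proof.
move=> /card_gt1_lt[_ [_ [[q1 [q2 [nq ->]]] [p1 [p2 [np ->]]] qp]]].
move=> /card_gt1_lt[_ [_ [[t1 [t2 [nt ->]]] [r1 [r2 [nr ->]]] tr]]].
have [C1 C1P] := finite_bound u1; have [C2 C2P] := finite_bound u2.
(* Twice the bound limits the gain from a first-round deviation; [m1] and [m2] rounds of punishment
   outweigh it. *)
have [m1 m1P] := mulrn_archi (C1 *+ 2) (etrans (subr_gt0 _ _) qp).
have [m2 m2P] := mulrn_archi (C2 *+ 2) (etrans (subr_gt0 _ _) tr).
have u_le (u : A1 -> A2 -> R) C x y z w : (forall a b, `|u a b| <= C) ->
    u x y - u z w <= C *+ 2.
  by move=> uC; have := uC x y; have := uC z w; rewrite !ler_norml; lra.
pose m := (m1 + m2)%N.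
pose p := (p1, p2); pose q := (q1, q2); pose r := (r1, r2); pose t := (t1, t2).
(* Each test detects a deviation by one player alone; joint deviations go unpunished. *)
exists (m + m)%N, (fun a' b' i => if (i < m)%N then
   (if (b' == b) && (a' != a) then q else p) else
   (if (a' == a) && (b' != b) then t else r)).
split; first by move=> a' b' i; do !case: ifP => _.
set w1 := fun a' b' => u1 a' b' + _; set w2 := fun a' b' => u2 a' b' + _.
have w1E a' b' : w1 a' b' = u1 a' b' +
    ((if (b' == b) && (a' != a) then eu u1 q1 q2 else eu u1 p1 p2) *+ m +
     (if (a' == a) && (b' != b) then eu u1 t1 t2 else eu u1 r1 r2) *+ m).
  rewrite /w1 (sum_prefix _ _ _ _ (fun p => eu u1 p.1 p.2)).
  by case: ifP => _; case: ifP.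
have w2E a' b' : w2 a' b' = u2 a' b' +
    ((if (b' == b) && (a' != a) then eu u2 q1 q2 else eu u2 p1 p2) *+ m +
     (if (a' == a) && (b' != b) then eu u2 t1 t2 else eu u2 r1 r2) *+ m).
  rewrite /w2 (sum_prefix _ _ _ _ (fun p => eu u2 p.1 p.2)).
  by case: ifP => _; case: ifP.
apply: nash_best_resp.
  apply/best_resp1P; split=> [|a']; first exact: mixed_pure.
  rewrite !eu_pure; have [->//|a'a] := eqVneq a' a.
  rewrite !w1E !eqxx (negbTE a'a) /= addrA [leRHS]addrA lerD2r.
  have : C1 *+ 2 <= (eu u1 p1 p2 - eu u1 q1 q2) *+ m.
    apply/ltW/(lt_le_trans m1P)/ler_wpMn2l; last exact: leq_addr.
    by rewrite subr_ge0 ltW.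
  have := u_le u1 C1 a' b a b C1P; rewrite mulrnBl; lra.
apply/best_resp2P; split=> [|b']; first exact: mixed_pure.
rewrite !eu_pure; have [->//|b'b] := eqVneq b' b.
rewrite !w2E !eqxx (negbTE b'b) /= addrCA [leRHS]addrCA lerD2l.
have : C2 *+ 2 <= (eu u2 r1 r2 - eu u2 t1 t2) *+ m.
  apply/ltW/(lt_le_trans m2P)/ler_wpMn2l; last exact: leq_addl.
  by rewrite subr_ge0 ltW.
have := u_le u2 C2 a b' a b C2P; rewrite mulrnBl; lra.
Qed.

(** Both equilibria pay player 2 the same, so choosing between them by [B] affects only player 1's
    incentives. *)
Lemma sustainable_reward (u1 u2 : A1 -> A2 -> R) (B : A1 -> A2 -> bool) N
    p1 p2 q1 q2 v s1 s2 :
  nash u1 u2 p1 p2 -> nash u1 u2 q1 q2 ->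
  eu u2 p1 p2 = v -> eu u2 q1 q2 = v ->
  best_resp1 (fun a b => u1 a b +
    (B a b)%:R * ((eu u1 p1 p2 - eu u1 q1 q2) *+ N)) s1 s2 ->
  best_resp2 u2 s1 s2 -> sustainable u1 u2 s1 s2.
Proof.
move=> np nq pv qv br1 br2.
exists N, (fun a b _ => if B a b then (p1, p2) else (q1, q2)).
split; first by move=> a b _; case: ifP.
have := nash_best_resp br1 br2.
move/(nash_addc _ _ (eu u1 q1 q2 *+ N) (v *+ N)).
apply: eq_nash => a b; rewrite sumr_const card_ord; case: ifP => _ /=;
  rewrite ?pv ?qv // -addrA; congr (_ + _).
  by rewrite mul1r -mulrnDl subrK.
by rewrite mul0r add0r.
Qed.

(* Rewarding each [a] in [F] exactly when the opponent plays [j a] gives an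
   M-matrix system for the mixture over [j @: F] that equalizes the payoffs of
   the actions in [F]. *)
Lemma indifference_reward u (F : {set A1}) (Y : {set A2}) (g : R) :
  0 < g -> F != set0 -> (#|F| <= #|Y|)%N ->
  exists s2 N (B : A1 -> A2 -> bool) c,
    let u' a b := u a b + (B a b)%:R * (g *+ N) in
    [/\ mixed s2, forall b, s2 b != 0 -> b \in Y,
        forall a, eu u' (pure a) s2 <= c &
        forall a, a \in F -> eu u' (pure a) s2 = c].
Proof.
move=> g0 F0 FY; have [j [jinj jY]] := set_injection F0 FY.
have [C CP] := finite_bound u.
pose P a b := if b \in F then C - u a (j b) else 0.
have P0 a b : 0 <= P a b.
  by rewrite /P; case: ifP => // _; rewrite subr_ge0 (le_trans (ler_norm _)).
have [N NP] := mulrn_archi (\sum_a \sum_b P a b) g0.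
have Plam a : \sum_b P a b < g *+ N.
  apply: le_lt_trans NP; rewrite [leRHS](bigD1 a) //= lerDl.
  by apply: sumr_ge0 => a' _; apply: sumr_ge0.
have [x [x0 xE]] := dominant_solution P0 Plam.
pose X := \sum_(a in F) x a.
have X0 : 0 < X.
  have /set0Pn[a aF] := F0; rewrite /X (bigD1 a) //= ltr_wpDr //.
  by apply: sumr_ge0 => a' _; apply: ltW.
pose s2 := [ffun b => \sum_(a in F) x a / X * (b == j a)%:R] : {ffun A2 -> R}.
have avg f : \sum_b s2 b * f b = \sum_(a in F) x a / X * f (j a).
  under eq_bigr => b _ do rewrite ffunE mulr_suml.
  rewrite exchange_big; apply: eq_bigr => a _.
  rewrite (bigD1 (j a)) //= eqxx mulr1 big1 ?addr0 // => b /negbTE ->.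
  by rewrite mulr0 mul0r.
have x1 : \sum_(a in F) x a / X = 1 by rewrite -mulr_suml divff // gt_eqF.
have s2m : mixed s2.
  split=> [b|].
    rewrite ffunE; apply: sumr_ge0 => a _.
    by rewrite mulr_ge0 ?ler0n // divr_ge0 // ltW.
  transitivity (\sum_b s2 b * 1); first by apply: eq_bigr => b _; rewrite mulr1.
  by rewrite avg -[RHS]x1; apply: eq_bigr => a _; rewrite mulr1.
exists s2, N, (fun a b => (a \in F) && (b == j a)), (X^-1 + C) => u'.
have eqF a : a \in F -> eu u' (pure a) s2 = X^-1 + C.
  move=> aF.
  (* Divided by [X], this says that the expected reward of [a] is [X^-1] plus the shortfall of its
     stage payoff below [C]; the total is then the same throughout [F]. *)
  have xF : x a * (g *+ N) = 1 + \sum_(b in F) x b * (C - u a (j b)).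
    rewrite mulrC xE; congr (1 + _); rewrite [RHS]big_mkcond.
    by apply: eq_bigr => b _; rewrite /P; case: ifP; rewrite ?mul0r // mulrC.
  rewrite eu_pure1 avg /u' aF /=.
  under eq_bigr => b _ do rewrite mulrDr.
  rewrite big_split /= (addrC (\sum_(b in F) _)) (bigD1 a) //= eqxx mul1r big1; last first.
    move=> b /andP[bF ba]; rewrite (_ : (j b == j a) = false) ?mul0r ?mulr0 //.
    by apply: contraNF ba => /eqP/jinj ->.
  rewrite addr0 mulrAC xF mulrDl mul1r -addrA; congr (_ + _).
  rewrite mulr_suml -big_split -[RHS]mulr1 -x1 mulr_sumr /=.
  by apply: eq_bigr => b _; ring.
split=> // [b|a].
  rewrite ffunE => /eqP s2b; apply: contrapT => bY; apply: s2b.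
  apply: big1 => a aF; rewrite (_ : (b == j a) = false) ?mulr0 //.
  by apply/negP => /eqP bj; apply: bY; rewrite bj jY.
have [/eqF -> //|aF] := boolP (a \in F).
rewrite eu_pure1; apply: le_trans (_ : C <= _); last by rewrite lerDr invr_ge0 ltW.
apply: mixed_avg_le => // b.
by rewrite /u' (negbTE aF) mul0r addr0 (le_trans (ler_norm _)).
Qed.

Lemma sustainable_asymmetric (u1 u2 : A1 -> A2 -> R) v s1 s2 :
  card_gt1 (V1 u1 u2) -> (forall t1 t2, nash u1 u2 t1 t2 -> eu u2 t1 t2 = v) ->
  mixed s1 -> ~ best_resp1 u1 s1 s2 -> best_resp2 u2 s1 s2 ->
  exists t1 t2, sustainable u1 u2 t1 t2 /\ ~ nash u1 u2 t1 t2.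
Proof.
move=> /card_gt1_lt[_ [_ [[q1 [q2 [nq ->]]] [p1 [p2 [np ->]]] qp]]] V2v m1 nbr1 br2.
have g0 : 0 < eu u1 p1 p2 - eu u1 q1 q2 by rewrite subr_gt0.
have [m2 _] := br2.
have rew := sustainable_reward np nq (V2v _ _ np) (V2v _ _ nq).
have [[a [t2 [br2a nbra]]]|pure_br] := pselect
    (exists a t2, best_resp2 u2 (pure a) t2 /\ ~ best_resp1 u1 (pure a) t2).
  exists (pure a), t2; split; last by case=> _ [_ []].
  have [C CP] := finite_bound u1; have [N NP] := mulrn_archi (C *+ 2) g0.
  have [mt _] := br2a.
  apply: (rew (fun a' _ => a' == a) N) => //.
  apply/best_resp1P; split=> [|a']; first exact: mixed_pure.
  have rE x : eu (fun a' b => u1 a' b +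
      (a' == a)%:R * ((eu u1 p1 p2 - eu u1 q1 q2) *+ N)) (pure x) t2 =
      eu u1 (pure x) t2 + (x == a)%:R * ((eu u1 p1 p2 - eu u1 q1 q2) *+ N).
    by rewrite eu_add; congr (_ + _); rewrite eu_pure1 mixed_avg.
  rewrite !rE eqxx mul1r; have [->|_] := eqVneq a' a; first by rewrite mul1r.
  have ub x : - C <= eu u1 (pure x) t2 <= C.
    have mx : mixed (pure x : {ffun A1 -> R}) by exact: mixed_pure.
    apply/andP; split.
      rewrite -[leLHS](eu_cst _ mx mt); apply: eu_le => // a1 b1.
      by have := CP a1 b1; rewrite ler_norml => /andP[].
    rewrite -[leRHS](eu_cst _ mx mt); apply: eu_le => // a1 b1.
    by have := CP a1 b1; rewrite ler_norml => /andP[].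
  rewrite mul0r addr0; have /andP[la _] := ub a; have /andP[_ ua] := ub a'.
  by move: NP la ua; set G := _ *+ N; lra.
have {}pure_br a t2 : best_resp2 u2 (pure a) t2 -> best_resp1 u1 (pure a) t2.
  by move=> h; apply: contrapT => h'; apply: pure_br; exists a, t2.
have [b0 _] := mixed_neq0 m2.
(* By [pure_br], a pure best reply to [a] forms an equilibrium with it, so each row maximum equals
   [v]. *)
have u2_le a b : u2 a b <= v.
  case: (@Order.TotalTheory.arg_maxP _ _ _ b0 predT (u2 a) isT) => y _ ymax.
  have bry : best_resp2 u2 (pure a) (pure y).
    apply/best_resp2P; split=> [|b']; first exact: mixed_pure.
    by rewrite !eu_pure; apply: ymax.
  have := V2v _ _ (nash_best_resp (pure_br _ _ bry) bry).
  by rewrite eu_pure => <-; apply: ymax.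
have row_le a t2 : mixed t2 -> eu u2 (pure a) t2 <= v.
  by move=> mt; rewrite eu_pure1; apply: mixed_avg_le.
(* With equality, [s2] would be a best reply to each action in the support of [s1]; by [pure_br]
   these actions, and hence [s1], would be optimal against [s2]. *)
have lt_v : eu u2 s1 s2 < v.
  rewrite eu_avg1 lt_neqAle (mixed_avg_le m1 (fun a => row_le a s2 m2)) andbT.
  apply/eqP => sv; apply: nbr1.
  have rowv := mixed_avg_max m1 (fun a => row_le a s2 m2) sv.
  have br1a a : s1 a != 0 -> best_resp1 u1 (pure a) s2.
    move=> /rowv av; apply: pure_br; apply/best_resp2P; split=> // b.
    by rewrite av row_le //; apply: mixed_pure.
  have [a sa] := mixed_neq0 m1.
  have [_ amax] := br1a a sa.
  apply: (best_resp1_supp (c := eu u1 (pure a) s2)) => // a'.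
    exact/amax/mixed_pure.
  move=> /br1a[_ a'max]; apply/le_anti; rewrite amax ?a'max //; exact: mixed_pure.
have [_ br2b] := (best_resp2P _ _ _).1 br2.
have [t1 [w [mt1 wle t1w cardle]]] := vertex_le b0 m1 br2b.
have supp0 : [set a | t1 a != 0] != set0.
  by have [a ta] := mixed_neq0 mt1; apply/set0Pn; exists a; rewrite inE.
have [t2 [N [B [c [mt2 t2Y lec eqc]]]]] := indifference_reward u1 g0 supp0 cardle.
have t2w : eu u2 t1 t2 = w.
  by rewrite eu_avg2; apply: mixed_avg_eq => // b /t2Y; rewrite inE => /eqP.
exists t1, t2; split; last first.
  (* Player 2 gets [w], at most the payoff at [(s1, s2)] and hence less than [v]. *)
  by move/V2v => tv; move: lt_v; rewrite -tv t2w ltNge wle.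
apply: (rew B N).
  by apply: (best_resp1_supp mt1 lec) => a ta; apply: eqc; rewrite inE.
by apply/best_resp2P; split=> // b; rewrite t2w.
Qed.

End Sustainability.

(** * Deepest suboptimal histories *)

Section Necessity.
Context {R : realType} {A1 A2 : finType}.
Implicit Types (u : A1 -> A2 -> R).

(** Induction on the remaining rounds, passing to a longer suboptimal history while there is one. *)
Lemma deepest_suboptimal (u1 u2 : A1 -> A2 -> R) T mu1 mu2 :
  locally_suboptimal u1 u2 T mu1 mu2 ->
  exists h, [/\ (size h < T)%N, ~ nash u1 u2 (mu1 h) (mu2 h) &
    forall h', (size h < size h' < T)%N -> nash u1 u2 (mu1 h') (mu2 h')].
Proof.
case=> k [h [+ [hk]]]; rewrite -{k}hk.
have [n] := ubnP (T - size h); elim: n h => // n IHn h ltn hT nn.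
have [[h' [/andP[hh' h'T] nn']]|all_nash] := pselect
    (exists h', (size h < size h' < T)%N /\ ~ nash u1 u2 (mu1 h') (mu2 h')).
  apply: (IHn h') => //; apply: leq_trans (_ : T - size h <= n)%N => //.
  exact: ltn_sub2l.
exists h; split=> // h' hh'; apply: contrapT => nn'; apply: all_nash.
by exists h'.
Qed.

End Necessity.

(** * The characterization *)

Section Characterization.
Context {R : realType} {A1 A2 : finType}.
Variables (u1 u2 : A1 -> A2 -> R).

Lemma V1_transpose x : V1 (transpose u2) (transpose u1) x <-> V2 u1 u2 x.
Proof.
split=> [[s2 [s1 [n ->]]]|[s1 [s2 [n ->]]]].
  by exists s1, s2; split; [apply/nash_transpose|apply: eu_transpose].
by exists s2, s1; split; [apply/nash_transpose|apply/esym/eu_transpose].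
Qed.

Lemma sustainable_of_cases :
  [\/ card_gt1 (V1 u1 u2) /\ card_gt1 (V2 u1 u2) /\
        (exists s1 s2, mixed s1 /\ mixed s2 /\ ~ nash u1 u2 s1 s2),
      card_gt1 (V1 u1 u2) /\ card_eq1 (V2 u1 u2) /\
        (exists s1 s2 a, mixed s1 /\ mixed s2 /\
           eu u1 s1 s2 < eu u1 (pure a) s2 /\ best_resp2 u2 s1 s2)
    | card_eq1 (V1 u1 u2) /\ card_gt1 (V2 u1 u2) /\
        (exists s1 s2 b, mixed s1 /\ mixed s2 /\
           eu u2 s1 s2 < eu u2 s1 (pure b) /\ best_resp1 u1 s1 s2)] ->
  exists s1 s2, sustainable u1 u2 s1 s2 /\ ~ nash u1 u2 s1 s2.
Proof.
case=> [[V1gt [V2gt [s1 [s2 [m1 [m2 nn]]]]]] |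
        [V1gt [[v V2v] [s1 [s2 [a [m1 [m2 [lt_a br]]]]]]]] |
        [[v V1v] [V2gt [s1 [s2 [b [m1 [m2 [lt_b br]]]]]]]]].
- have [a [b nab]] := pure_not_nash m1 m2 nn.
  by exists (pure a), (pure b); split=> //; apply: sustainable_pure.
- apply: (sustainable_asymmetric (v := v) V1gt _ m1 _ br).
    by move=> t1 t2 n; apply/V2v; exists t1, t2.
  by move=> /best_resp1P[_ /(_ a)]; rewrite leNgt lt_a.
(* Case (3) is case (2) with the players exchanged. *)
- have [||||t2 [t1 [sus nn]]] :=
      @sustainable_asymmetric _ _ _ (transpose u2) (transpose u1) v s2 s1 _ _ m2.
  + have [x [y [Vx [Vy xy]]]] := V2gt; exists x, y.
    by split; [|split] => //; apply/V1_transpose.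
  + move=> t2 t1 n; rewrite eu_transpose; apply/V1v; exists t1, t2; split=> //.
    exact/nash_transpose.
  + by move=> /best_resp1_transpose/best_resp2P[_ /(_ b)]; rewrite leNgt lt_b.
  + exact/best_resp2_transpose.
  exists t1, t2; split; first exact: sustainable_transpose.
  by move=> n; apply: nn; apply/nash_transpose.
Qed.

(** All later profiles are stage equilibria paying player 1 [v], so the game at [h] differs from the
    stage game by a constant. *)
Lemma best_resp1_V1_cst T mu1 mu2 v h :
  SPE u1 u2 T mu1 mu2 -> is_behav mu1 -> is_behav mu2 -> (size h < T)%N ->
  (forall h', (size h < size h' < T)%N -> nash u1 u2 (mu1 h') (mu2 h')) ->
  (forall x, V1 u1 u2 x -> x = v) -> best_resp1 u1 (mu1 h) (mu2 h).
Proof.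
move=> spe m1 m2 hT nh V1v.
have [_ [_ [br _]]] := SPE_nash_aux_game spe hT.
apply/(best_resp1_addc u1 (v *+ (T - (size h).+1)) (mu1 h) (m2 h)).
have [? le] := br; split=> // t1 mt; move: (le t1 mt).
suff e a b : aux_game u1 (T - (size h).+1) mu1 mu2 h a b =
    u1 a b + v *+ (T - (size h).+1) by rewrite !(eq_eu _ _ e).
congr (_ + _); apply: rpay_stage_cst => // h'.
rewrite size_rcons subnKC // => lt; apply: V1v.
by exists (mu1 h'), (mu2 h'); split=> //; apply: nh.
Qed.

Lemma best_resp2_V2_cst T mu1 mu2 v h :
  SPE u1 u2 T mu1 mu2 -> is_behav mu1 -> is_behav mu2 -> (size h < T)%N ->
  (forall h', (size h < size h' < T)%N -> nash u1 u2 (mu1 h') (mu2 h')) ->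
  (forall x, V2 u1 u2 x -> x = v) -> best_resp2 u2 (mu1 h) (mu2 h).
Proof.
move=> spe m1 m2 hT nh V2v.
have [_ [_ [_ br]]] := SPE_nash_aux_game spe hT.
apply/(best_resp2_addc u2 (v *+ (T - (size h).+1)) (mu2 h) (m1 h)).
have [? le] := br; split=> // t2 mt; move: (le t2 mt).
suff e a b : aux_game u2 (T - (size h).+1) mu1 mu2 h a b =
    u2 a b + v *+ (T - (size h).+1) by rewrite !(eq_eu _ _ e).
congr (_ + _); apply: rpay_stage_cst => // h'.
rewrite size_rcons subnKC // => lt; apply: V2v.
by exists (mu1 h'), (mu2 h'); split=> //; apply: nh.
Qed.

End Characterization.

Unset Implicit Arguments.

Theorem mainTheorem4 (R : realType) (A1 A2 : finType) (u1 u2 : A1 -> A2 -> R)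
  (hA1 : (0 < #|A1|)%N) (hA2 : (0 < #|A2|)%N) :
  (exists (T : nat) (mu1 : behav A1) (mu2 : behav A2),
      (1 <= T)%N /\ SPE u1 u2 T mu1 mu2 /\ locally_suboptimal u1 u2 T mu1 mu2)
  <->
  [\/ card_gt1 (V1 u1 u2) /\ card_gt1 (V2 u1 u2) /\
        (exists (s1 : {ffun A1 -> R}) (s2 : {ffun A2 -> R}),
           mixed s1 /\ mixed s2 /\ ~ nash u1 u2 s1 s2),
      card_gt1 (V1 u1 u2) /\ card_eq1 (V2 u1 u2) /\
        (exists (s1 : {ffun A1 -> R}) (s2 : {ffun A2 -> R}) (a1' : A1),
           mixed s1 /\ mixed s2 /\ eu u1 s1 s2 < eu u1 (pure a1') s2 /\
           best_resp2 u2 s1 s2)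
    | card_eq1 (V1 u1 u2) /\ card_gt1 (V2 u1 u2) /\
        (exists (s1 : {ffun A1 -> R}) (s2 : {ffun A2 -> R}) (a2' : A2),
           mixed s1 /\ mixed s2 /\ eu u2 s1 s2 < eu u2 s1 (pure a2') /\
           best_resp1 u1 s1 s2)].
Proof.
split=> [[T [mu1 [mu2 [T1 [spe sub]]]]]|cases]; last first.
  have [s1 [s2 [sus nn]]] := sustainable_of_cases cases.
  exact: sustainable_SPE sus nn.
have [m1 [m2 _]] := spe 0%N [::] T1 erefl.
have /card_gt0P[a0 _] := hA1; have /card_gt0P[b0 _] := hA2.
(* The last round of an SPE, after a history of length [T.-1], is a stage equilibrium; hence both
   value sets are nonempty. *)
have [w1 [w2 nw]] : exists s1 s2, nash u1 u2 s1 s2.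
  pose h := nseq T.-1 (a0, b0); have sh : (size h).+1 = T by rewrite size_nseq prednK.
  have hT : (size h < T)%N by rewrite sh.
  have := SPE_nash_aux_game spe hT; rewrite sh subnn => n.
  exists (mu1 h), (mu2 h); apply: eq_nash n => a b; exact: addr0.
have [h [hT nn deep]] := deepest_suboptimal sub.
have br1 v : (forall x, V1 u1 u2 x <-> x = v) -> best_resp1 u1 (mu1 h) (mu2 h).
  move=> V1v; apply: (best_resp1_V1_cst spe m1 m2 hT deep) => x.
  exact: (iffLR (V1v x)).
have br2 v : (forall x, V2 u1 u2 x <-> x = v) -> best_resp2 u2 (mu1 h) (mu2 h).
  move=> V2v; apply: (best_resp2_V2_cst spe m1 m2 hT deep) => x.
  exact: (iffLR (V2v x)).
have m1h : mixed (mu1 h) by exact: m1.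
have m2h : mixed (mu2 h) by exact: m2.
have V1w : V1 u1 u2 (eu u1 w1 w2) by exists w1, w2.
have V2w : V2 u1 u2 (eu u2 w1 w2) by exists w1, w2.
have [V1gt|[v1 V1v]] := card_gt1_or_eq1 V1w;
  have [V2gt|[v2 V2v]] := card_gt1_or_eq1 V2w.
- by constructor 1; split=> //; split=> //; exists (mu1 h), (mu2 h).
- constructor 2; split=> //; split; first by exists v2.
  have {}br2 := br2 _ V2v.
  suff [a lt_a] : exists a, eu u1 (mu1 h) (mu2 h) < eu u1 (pure a) (mu2 h).
    by exists (mu1 h), (mu2 h), a.
  apply: contrapT => no; apply: nn; apply: nash_best_resp => //.
  apply/best_resp1P; split=> // a; rewrite leNgt; apply/negP => ?.
  by apply: no; exists a.
- constructor 3; split; first by exists v1.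
  split=> //; have {}br1 := br1 _ V1v.
  suff [b lt_b] : exists b, eu u2 (mu1 h) (mu2 h) < eu u2 (mu1 h) (pure b).
    by exists (mu1 h), (mu2 h), b.
  apply: contrapT => no; apply: nn; apply: nash_best_resp => //.
  apply/best_resp2P; split=> // b; rewrite leNgt; apply/negP => ?.
  by apply: no; exists b.
- by case: nn; apply: nash_best_resp; [apply: br1 V1v|apply: br2 V2v].
Qed.
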